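(* $$\int_0^{\pi/2} e^{-\cot^2(x)}\,dx = \frac{e\pi}{2}\,\mathrm{erfc}(1).$$
   Context: The complementary error function is $\mathrm{erfc}(x)=\frac{2}{\sqrt{\pi}}\int_x^{\infty} e^{-t^2}\,dt$. *)

(* Defs.v *)
From HB Require Import structures.
From mathcomp Require Import all_boot all_order all_algebra.
From mathcomp Require Import all_classical all_reals all_analysis.
Set Implicit Arguments.
Unset Strict Implicit.
Unset Printing Implicit Defensive.
Import Order.TTheory GRing.Theory Num.Theory.
Import numFieldNormedType.Exports.
Local Open Scope classical_set_scope.
Local Open Scope ring_scope.

(* Like tan in the library, total: cot x = 0 by convention when sin x = 0. *)
Definition cot (R : realType) (x : R) : R := cos x / sin x.

Definition erfc (R : realType) (x : R) : R :=
  2 / Num.sqrt pi *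
  \int[@lebesgue_measure R]_(t in `[x, +oo[) expR (- t ^+ 2).

(* Main.v *)
Require Import Defs.
From HB Require Import structures.
From mathcomp Require Import all_boot all_order all_algebra.
From mathcomp Require Import all_classical all_reals all_analysis.
From mathcomp Require Import measurable_realfun.
From mathcomp Require Import ring lra.
Set Implicit Arguments.
Unset Strict Implicit.
Unset Printing Implicit Defensive.
Import Order.TTheory GRing.Theory Num.Theory.
Import numFieldNormedType.Exports.
Local Open Scope classical_set_scope.
Local Open Scope ring_scope.

(* The substitution u = cot x turns the integral into that of
   exp(-u^2) / (1 + u^2) over [0, +oo[.  Since exp(-c) / c is the integral of
   2 s exp(-s^2 c) over s >= 1, taking c = 1 + u^2 and exchanging the integrals
   (Tonelli) leaves, for each s >= 1, exp(-s^2) times the Gaussian integral of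
   2 s exp(-(s u)^2) over u >= 0, which is sqrt(pi) whatever s is. *)

Lemma sin_gt0_oc_pihalf (R : realType) (x : R) :
  x \in `]0, pi / 2] -> 0 < sin x.
Proof.
move=> /[!in_itv]/= /andP[x0 xpi]; apply: sin_gt0_pi; rewrite x0/=.
by have := pi_gt0 R; lra.
Qed.

Lemma continuous_expRN_cot2 (R : realType) (x : R) : sin x != 0 ->
  {for x, continuous (fun y : R => expR (- cot y ^+ 2))}.
Proof.
move=> s0; apply: continuous_comp; last exact: continuous_expR.
apply: continuousN; apply: (@continuous_comp _ _ _ (@cot R) (fun y => y ^+ 2)).
  apply: cvgM; first exact: continuous_cos.
  by apply: cvgV => //; exact: continuous_sin.
exact: exprn_continuous.
Qed.

(** This makes [pi / 2 - atan u] the explicit inverse of [cot], so that it can serve as the change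
    of variable; the cofunction identities reduce the claim to [atanK]. *)
Lemma cot_pihalfB_atan (R : realType) (u : R) : cot (pi / 2 - atan u) = u.
Proof.
rewrite /cot -opprB cosN cosBpihalf sinN sinBpihalf opprK.
by rewrite -[RHS]atanK.
Qed.

Lemma derive1_pihalfB_atan (R : realType) :
  derive1 (fun u : R => pi / 2 - atan u) = (fun u => - (oneDsqr u)^-1).
Proof.
apply/funext => u; rewrite derive1E deriveB//.
by rewrite derive_cst sub0r -derive1E derive1_atan.
Qed.

Lemma continuous_pihalfB_atan (R : realType) :
  continuous (fun u : R => pi / 2 - atan u).
Proof. by move=> u; apply: cvgB; [exact: cvg_cst|exact: continuous_atan]. Qed.

(** Substitute [x = pi / 2 - atan u], which is decreasing: the minus sign of its derivative cancels
    against the reversed orientation. Truncating at [b] keeps [x] away from the pole of [cot] at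
    0. *)
Lemma integral_expRN_cot2_cc (R : realType) (b : R) : 0 <= b ->
  (\int[@lebesgue_measure R]_(x in `[(pi / 2 - atan b)%R, (pi / 2)%R])
     (expR (- (cot x) ^+ 2))%:E
   = \int[@lebesgue_measure R]_(u in `[0%R, b])
     (expR (- u ^+ 2) / oneDsqr u)%:E)%E.
Proof.
move=> b0; pose F (u : R) := pi / 2 - atan u.
have F0 : F 0 = pi / 2 by rewrite /F atan0 subr0.
rewrite -/(F b) -F0 (@integration_by_substitution_decreasing _ F)//.
- by apply: eq_integral => u _; rewrite !fctE cot_pihalfB_atan
    derive1_pihalfB_atan opprK.
- by move=> x y _ _ xy; rewrite /F ler_ltB// lt_atan.
- by rewrite derive1_pihalfB_atan => x _; apply: cvgN;
    exact: continuous_oneDsqrV.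
- rewrite derive1_pihalfB_atan; apply: is_cvgN; apply/cvg_ex; eexists.
  by apply: cvg_at_right_filter; exact: continuous_oneDsqrV.
- rewrite derive1_pihalfB_atan; apply: is_cvgN; apply/cvg_ex; eexists.
  by apply: cvg_at_left_filter; exact: continuous_oneDsqrV.
- split.
  + by move=> x _; exact: derivableB.
  + by apply: cvg_at_right_filter; exact: continuous_pihalfB_atan.
  + by apply: cvg_at_left_filter; exact: continuous_pihalfB_atan.
- apply: continuous_in_subspaceT => x /[!inE]/= /[!in_itv]/= /andP[Fbx xF0].
  apply: continuous_expRN_cot2; rewrite gt_eqF// sin_gt0_oc_pihalf//.
  rewrite in_itv/= (lt_le_trans _ Fbx) ?subr_gt0 ?atan_ltpi2//=.
  by rewrite -F0.
Qed.

Lemma measurable_expRN_sqr_oneDsqr (R : realType) :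
  measurable_fun setT (fun u : R => expR (- u ^+ 2) / oneDsqr u).
Proof.
apply: measurable_funM; first exact: measurable_gauss_fun.
by apply: continuous_measurable_fun; exact: continuous_oneDsqrV.
Qed.

(** [atan n%:R] tends to [pi / 2] without reaching it, so the left endpoints come arbitrarily close
    to 0 and stay positive. *)
Lemma pihalf_itvoc_bigcup (R : realType) :
  `]0%R, (pi / 2)%R]%classic =
  \bigcup_n `[(pi / 2 - atan n%:R)%R, (pi / 2)%R]%classic :> set R.
Proof.
apply/seteqP; split => x/=.
- rewrite in_itv/= => /andP[x0 xpi].
  have : \forall n \near \oo, pi / 2 - x < atan (n%:R : R).
    have := (cvgr_gt _ (@cvgy_atan R)) (pi / 2 - x).
    by rewrite ltrBlDr ltrDl => /(_ _ x0)/cvgr_idn.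
  move=> [n _ /(_ n (leqnn n))/= nx]; exists n => //=.
  by rewrite in_itv/= xpi andbT; lra.
- move=> [n _]/=; rewrite !in_itv/= => /andP[nx ->]; rewrite andbT.
  by rewrite (lt_le_trans _ nx)// subr_gt0 atan_ltpi2.
Qed.

(** Both sides are limits of the truncated integrals at [b = n], by monotone convergence along
    growing domains, and the truncated integrals agree for every [n]. *)
Lemma integral_expRN_cot2_oc (R : realType) :
  (\int[@lebesgue_measure R]_(x in `]0%R, (pi / 2)%R])
     (expR (- (cot x) ^+ 2))%:E
   = \int[@lebesgue_measure R]_(u in `[0%R, +oo[)
     (expR (- u ^+ 2) / oneDsqr u)%:E)%E.
Proof.
rewrite pihalf_itvoc_bigcup; set A := fun n : nat => _ : set R.
have mA i : measurable (A i) by exact: measurable_itv.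
have mg i : measurable_fun (A i) (fun x : R => (expR (- cot x ^+ 2))%:E).
  apply/measurable_EFinP.
  apply: subspace_continuous_measurable_fun; first exact: mA.
  apply: continuous_in_subspaceT => x xA; apply: continuous_expRN_cot2.
  rewrite gt_eqF// sin_gt0_oc_pihalf//.
  suff : `]0, pi / 2]%classic x by [].
  by rewrite pihalf_itvoc_bigcup; exists i => //; exact: set_mem xA.
have ndA : nondecreasing_seq A.
  move=> m n mn; apply/subsetPset => x/=; rewrite /A/= !in_itv/=.
  move=> /andP[mx ->]; rewrite andbT (le_trans _ mx)// lerB// le_atan//.
  by rewrite ler_nat.
have cvgA : (\int[@lebesgue_measure R]_(x in A n) (expR (- cot x ^+ 2))%:E
    @[n --> \oo] --> \int[@lebesgue_measure R]_(x in \bigcup_n A n)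
      (expR (- cot x ^+ 2))%:E)%E.
  by apply: ge0_nondecreasing_set_cvg_integral => // i x _;
    rewrite lee_fin expR_ge0.
have f0 (u : R) : 0 <= expR (- u ^+ 2) / oneDsqr u.
  by rewrite divr_ge0// expR_ge0.
have cvgy := @ge0_cvgn_integral _ lebesgue_measure _ f0
  (@measurable_expRN_sqr_oneDsqr R).
rewrite -(cvg_lim _ cvgA)// -(cvg_lim _ cvgy)//.
by under eq_fun do rewrite integral_expRN_cot2_cc//.
Qed.

(** The antiderivative [F] tends to 0 at infinity because [c] is positive, so only [- F 1]
    remains. *)
Lemma integral1y_expRN_sqrM (R : realType) (c : R) : 0 < c ->
  (\int[@lebesgue_measure R]_(s in `[1%R, +oo[)
     (2 * s * expR (- (s ^+ 2 * c)))%:E = (expR (- c) / c)%:E)%E.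
Proof.
move=> c0; have cN0 : c != 0 by rewrite gt_eqF.
pose F (s : R) := - c^-1 * expR (- (s ^+ 2 * c)).
have dF (s : R) : is_derive s 1 F (2 * s * expR (- (s ^+ 2 * c))).
  rewrite /F; apply: is_derive_eq.
  rewrite /GRing.scale/=; field.
  exact: cN0.
have cF : continuous F.
  by move=> s; apply/differentiable_continuous/derivable1_diffP.
have cf : continuous (fun s : R => 2 * s * expR (- (s ^+ 2 * c))).
  move=> s; apply: differentiable_continuous; apply/derivable1_diffP.
  exact: ex_derive.
rewrite (@ge0_continuous_FTC2y _ _ F _ 0).
- by rewrite /F expr1n mul1r sub0e -EFinN mulNr opprK mulrC.
- by move=> s s1; rewrite !mulr_ge0 ?expR_ge0//; lra.
- exact: continuous_subspaceT.
- rewrite -[X in _ --> X](mulr0 (- c^-1)); apply: cvgMl_tmp.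
  apply: (cvg_comp (fun s : R => s ^+ 2 * c) (fun y => expR (- y))).
    by apply: gt0_cvgMly => //; exact: cvgr_expr2.
  exact: cvgr_expR.
- by move=> s _; exact: ex_derive.
- by apply: cvg_at_right_filter; exact: cF.
- by move=> s _; rewrite derive1E derive_val.
Qed.

(** The factor [s] is exactly the Jacobian of [v = s * u], which is why the value does not depend on
    [s]. *)
Lemma integral0y_gauss_scale (R : realType) (s : R) : 0 < s ->
  (\int[@lebesgue_measure R]_(u in `[0%R, +oo[)
     (s * gauss_fun (s * u))%:E = (Num.sqrt pi / 2)%:E)%E.
Proof.
move=> s0; have ds : derive1 (fun u : R => s * u) = cst s.
  by apply/funext => u; rewrite derive1E deriveZ//= derive_id /GRing.scale/= mulr1.
rewrite -integral0y_gauss; apply/esym.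
(* The lower bound 0 is written as the image of 0 under the substitution, the shape that the rule
   expects. *)
transitivity (\int[lebesgue_measure]_(x in `[(s * 0)%R, +oo[)
    (gauss_fun x)%:E)%E; first by rewrite mulr0.
rewrite (@increasing_ge0_integration_by_substitutiony _ (fun u => s * u))//.
- by apply: eq_integral => u _; rewrite !fctE ds /= mulrC.
- by move=> x y _ _ xy; rewrite ltr_pM2l.
- by rewrite ds => x _; exact: cvg_cst.
- by rewrite ds; exact: is_cvg_cst.
- by rewrite ds; exact: is_cvg_cst.
- split; first by move=> x _; exact: derivableZ.
  by apply: cvg_at_right_filter; apply: cvgMl_tmp; exact: cvg_id.
- by apply: gt0_cvgMry => //; exact: cvg_id.
- by apply: continuous_subspaceT; exact: continuous_gauss_fun.
- by move=> x _; exact: gauss_fun_ge0.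
Qed.

Lemma integrable_gauss_fun_itv1y (R : realType) :
  (@lebesgue_measure R).-integrable `[1%R, +oo[ (EFin \o gauss_fun).
Proof. exact: integrableS (@integrableT_gauss R). Qed.

Lemma integral_gauss_oneDsqr (R : realType) :
  (\int[@lebesgue_measure R]_(u in `[0%R, +oo[)
     (expR (- oneDsqr u) / oneDsqr u)%:E
   = (Num.sqrt pi)%:E *
     \int[@lebesgue_measure R]_(s in `[1%R, +oo[) (gauss_fun s)%:E)%E.
Proof.
set mu := @lebesgue_measure R.
pose A : set R := `[0%R, +oo[%classic; pose B : set R := `[1%R, +oo[%classic.
pose k (u s : R) : R := 2 * s * expR (- (s ^+ 2 * oneDsqr u)).
(* The indicators extend [k] by zero to the whole plane, where Tonelli applies; the one of [B] also
   removes the negative [s], for which [k] is negative. *)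
pose f (z : R * R) : \bar R := (k z.1 z.2 * \1_A z.1 * \1_B z.2)%:E.
have mA : measurable A by exact: measurable_itv.
have mB : measurable B by exact: measurable_itv.
have mf : measurable_fun setT f.
  apply/measurable_EFinP; rewrite /k; apply: measurable_funM; last first.
    by apply: (measurableT_comp _ measurable_snd); exact: measurable_indic.
  apply: measurable_funM; last first.
    by apply: (measurableT_comp _ measurable_fst); exact: measurable_indic.
  apply: measurable_funM; first exact: measurable_funM.
  apply: measurableT_comp => //; apply: measurableT_comp => //.
  apply: measurable_funM; first exact: measurable_funX.
  by apply: (measurableT_comp _ measurable_fst); apply: continuous_measurable_fun;
    exact: continuous_oneDsqr.
have k0 u s : B s -> 0 <= k u s.
  rewrite /B/= in_itv/= andbT => s1.
  by rewrite /k !mulr_ge0 ?expR_ge0//; lra.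
have f0 z : (0 <= f z)%E.
  rewrite lee_fin /f mulrAC mulr_ge0// [X in _ * X]indicE.
  have [|] := boolP (z.2 \in B); last by rewrite mulr0.
  by rewrite inE mulr1; exact: k0.
have fA (u : R) : A u -> (fun s => f (u, s)) = (EFin \o k u) \_ B.
  move=> Au; rewrite epatch_indic; apply/funext => s.
  by rewrite /f/= [\1_A u]indicE mem_set// mulr1 EFinM.
have fB (s : R) : B s -> (fun u => f (u, s)) = (EFin \o k^~ s) \_ A.
  move=> Bs; rewrite epatch_indic; apply/funext => u.
  by rewrite /f/= [\1_B s]indicE mem_set// mulr1 EFinM.
(* For [u] in [A], integrating over [s] first gives back the integrand on the left, with
   [c = oneDsqr u]. *)
transitivity (\int[mu]_u \int[mu]_s f (u, s))%E.
  rewrite integral_mkcond; apply: eq_integral => u _; rewrite patchE.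
  case: ifPn => [/set_mem Au|uA].
    by rewrite fA// -integral_mkcond integral1y_expRN_sqrM.
  rewrite integral0_eq// => s _.
  by rewrite /f/= [\1_A u]indicE (negbTE uA) mulr0 mul0r.
(* After the exchange, [Num.sqrt pi] is moved under the integral on the right, so that both sides
   can be compared for each fixed [s]. *)
rewrite fubini_tonelli// -ge0_integralZl_EFin//; last first.
- by apply/measurable_EFinP/measurable_funTS; exact: measurable_gauss_fun.
- by move=> s _; rewrite lee_fin gauss_fun_ge0.
rewrite [RHS]integral_mkcond; apply: eq_integral => s _; rewrite patchE.
case: ifPn => [/set_mem Bs|sB]; last first.
  rewrite integral0_eq// => u _.
  by rewrite /f/= [\1_B s]indicE (negbTE sB) mulr0.
have s0 : 0 < s by move: Bs; rewrite /B/= in_itv/= andbT; lra.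
rewrite fB// -integral_mkcond.
(* Since s^2 (1 + u^2) = s^2 + (s u)^2, the kernel splits into a factor free of [u] and a rescaled
   Gaussian. *)
transitivity (\int[mu]_(u in A)
    ((2 * gauss_fun s)%:E * (s * gauss_fun (s * u))%:E))%E.
  apply: eq_integral => u _; rewrite -EFinM /= /k /gauss_fun; congr EFin.
  rewrite mulrACA -expRD; congr (_ * expR _).
  by rewrite /oneDsqr; ring.
rewrite ge0_integralZl_EFin//; last 3 first.
- by move=> u _; rewrite lee_fin mulr_ge0 ?gauss_fun_ge0// ltW.
- apply/measurable_EFinP/measurable_funTS; apply: measurable_funM => //.
  apply: measurableT_comp; first exact: measurable_gauss_fun.
  exact: measurable_funM.
- by rewrite mulr_ge0 ?gauss_fun_ge0.
rewrite integral0y_gauss_scale// -!EFinM; congr EFin.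
by field.
Qed.

(* The integrand is undefined at 0 (cot has a pole there), hence the interval
   is open at 0; the integral is extended-real valued, so the equation also
   says that it is finite. *)
Theorem theorem3p4 (R : realType) :
  (\int[@lebesgue_measure R]_(x in `]0%R, (pi / 2)%R])
     (expR (- (cot x) ^+ 2))%:E)%E
  = (expR 1 * pi / 2 * erfc 1)%:E.
Proof.
rewrite integral_expRN_cot2_oc.
(* The factor e of the result arises here: exp(-u^2) = e exp(-(1 + u^2)) puts the same quantity 1 +
   u^2 in the exponent and in the denominator. *)
transitivity (\int[@lebesgue_measure R]_(u in `[0%R, +oo[)
    ((expR 1)%:E * (expR (- oneDsqr u) / oneDsqr u)%:E))%E.
  apply: eq_integral => u _; rewrite -EFinM mulrA -expRD.
  by congr (expR _ / _)%:E; rewrite /oneDsqr; ring.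
rewrite ge0_integralZl_EFin//; last first.
  apply/measurable_EFinP/measurable_funTS.
  apply: continuous_measurable_fun => u; apply: cvgM.
    apply: continuous_comp; last exact: continuous_expR.
    by apply: cvgN; exact: continuous_oneDsqr.
  exact: continuous_oneDsqrV.
rewrite integral_gauss_oneDsqr.
(* [erfc] is built on the real-valued integral; finiteness of the Gaussian tail lets the
   extended-real equation descend to the reals. *)
rewrite -(fineK (integrable_fin_num _ (@integrable_gauss_fun_itv1y R)))//.
rewrite -!EFinM /erfc; congr EFin.
rewrite -[fine _]/(\int[lebesgue_measure]_(s in `[1, +oo[) gauss_fun s).
have spi : Num.sqrt pi != 0 :> R by rewrite gt_eqF// sqrtr_gt0 pi_gt0.
(* Writing [pi] as the square of its root lets it absorb the [2 / Num.sqrt pi] of [erfc], leaving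
   one [Num.sqrt pi]. *)
rewrite -{2}(sqr_sqrtr (pi_ge0 R)) /gauss_fun.
by field.
Qed.
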